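(* Let $k,l\geq 1$ and $n\geq 2$ be integers. Then the order of the abelianisation of $F^{k/l}(n)$ is $$|F^{k/l}(n)^{\mathrm{ab}}|=\begin{cases}V_n^{k/l}&\text{if } n \text{ is odd};\\ V_n^{k/l}-2l^n&\text{if } n\text{ is even}.\end{cases}$$
   Context: For integers $n,k,l\geq 1$, $$F^{k/l}(n)=\langle x_0,\ldots,x_{n-1}\mid x_i^l x_{i+1}^k=x_{i+2}^l\ (0\leq i<n)\rangle,$$ with subscripts taken modulo $n$. The natural numbers $V_j^{k/l}$ are defined by $$V_1^{k/l}=k,\quad V_2^{k/l}=k^2+2l^2,\quad V_j^{k/l}=kV_{j-1}^{k/l}+l^2V_{j-2}^{k/l}\ (j\geq 3).$$ *)

(* Defs.v *)
From HB Require Import structures.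
From mathcomp Require Import all_boot.
From mathcomp Require Import boolp classical_sets functions cardinality.

Set Implicit Arguments.
Unset Strict Implicit.
Unset Printing Implicit Defensive.

Local Open Scope card_scope.
Local Open Scope classical_set_scope.
Local Open Scope group_scope.
Local Open Scope quotient_scope.

Section Subgroups.
Variable G : groupType.
Implicit Types (A H N : set G) (x y : G).

Definition is_subgroup H := H 1 /\ forall x y, H x -> H y -> H (x / y).

Definition is_normal_subgroup N :=
  is_subgroup N /\ forall x y, N x -> N (x ^ y).

Definition generated_subgroup A : set G :=
  [set x | forall H, is_subgroup H -> A `<=` H -> H x].

Definition normal_closure A : set G :=
  [set x | forall N, is_normal_subgroup N -> A `<=` N -> N x].

Definition commutator_subgroup : set G :=
  generated_subgroup [set z | exists x y, z = [~ x, y]].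

Lemma normal_closureP A : is_normal_subgroup (normal_closure A).
Proof.
split=> [|x y clx N nN AN]; last by case: (nN) => _; apply; apply: clx.
split=> [N [[N1 _] _] _ //|x y clx cly N nN AN].
by case: (nN) => -[_ NF] _; apply: NF; [apply: clx|apply: cly].
Qed.

Lemma commutator_subgroupP : is_normal_subgroup commutator_subgroup.
Proof.
have subC : is_subgroup commutator_subgroup.
  split=> [H [H1 _] _ //|x y cx cy H sH AH].
  by case: (sH) => _; apply; [apply: cx|apply: cy].
split=> // x y cx H sH AH; have Hx := cx H sH AH.
have HR : H [~ x, y] by apply: AH; exists x, y.
have HV z : H z -> H z^-1 by case: sH => H1 HF Hz; rewrite -div1g; apply: HF.
have -> : x ^ y = x / [~ x, y]^-1 by rewrite invgK commgEl mulVKg.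
by case: sH => _; apply => //; apply: HV.
Qed.

End Subgroups.

Record normalSubgroup (G : groupType) := NormalSubgroup {
  normal_set : set G;
  normal_setP : is_normal_subgroup normal_set }.

Section QuotientGroup.
Variables (G : groupType) (N : normalSubgroup G).
Implicit Types x y z : G.

Let S := normal_set N.
Let N1 : S 1. Proof. by case: (normal_setP N) => -[]. Qed.
Let NF x y : S x -> S y -> S (x / y).
Proof. by case: (normal_setP N) => -[_ + _]; apply. Qed.
Let NJ x y : S x -> S (x ^ y).
Proof. by case: (normal_setP N) => _; apply. Qed.
Let NV x : S x -> S x^-1. Proof. by rewrite -div1g; apply: NF. Qed.
Let NM x y : S x -> S y -> S (x * y).
Proof. by move=> Nx Ny; rewrite -[y]invgK; apply/NF/NV. Qed.

Definition coset_rel x y : bool := `[< normal_set N (x^-1 * y) >].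

Let coset_relP x y : reflect (S (x^-1 * y)) (coset_rel x y).
Proof. exact: asboolP. Qed.

Fact coset_rel_refl : reflexive coset_rel.
Proof. by move=> x; apply/coset_relP; rewrite mulVg. Qed.

Fact coset_rel_sym : symmetric coset_rel.
Proof.
by move=> x y; apply/coset_relP/coset_relP => /NV; rewrite invgM invgK.
Qed.

Fact coset_rel_trans : transitive coset_rel.
Proof.
move=> y x z /coset_relP Nxy /coset_relP Nyz; apply/coset_relP.
by have := NM Nxy Nyz; rewrite -mulgA mulVKg.
Qed.

Canonical coset_equiv :=
  EquivRel coset_rel coset_rel_refl coset_rel_sym coset_rel_trans.

Definition quotient_group := {eq_quot coset_equiv}.
HB.instance Definition _ := Choice.on quotient_group.
HB.instance Definition _ := EqQuotient.on quotient_group.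

Definition quotient_one : quotient_group := \pi_quotient_group 1.
Definition quotient_inv (a : quotient_group) : quotient_group :=
  \pi_quotient_group ((repr a)^-1).
Definition quotient_mul (a b : quotient_group) : quotient_group :=
  \pi_quotient_group (repr a * repr b).

Let pi_surj a : exists x, a = \pi_quotient_group x.
Proof. by exists (repr a); rewrite reprK. Qed.

Let pi_eq x y : S (x^-1 * y) -> \pi_quotient_group x = \pi_quotient_group y.
Proof. by move=> /coset_relP ?; apply/eqP; rewrite eqmodE. Qed.

Let pi_repr x : S (x^-1 * repr (\pi_quotient_group x)).
Proof.
apply/coset_relP.
have /eqP : x = repr (\pi_quotient_group x) %[mod quotient_group].
  by rewrite reprK.
by rewrite eqmodE.
Qed.

Lemma quotient_piV x :
  quotient_inv (\pi_quotient_group x) = \pi_quotient_group (x^-1).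
Proof.
rewrite /quotient_inv; apply/esym/pi_eq; set y := repr _.
rewrite invgK; have := NJ x^-1 (NV (pi_repr x)).
by rewrite conjgE !invgM !invgK -/y !mulgA mulgK.
Qed.

Lemma quotient_piM x y :
  quotient_mul (\pi_quotient_group x) (\pi_quotient_group y) =
  \pi_quotient_group (x * y).
Proof.
rewrite /quotient_mul; apply/esym/pi_eq.
set x' := repr _; set y' := repr (\pi_quotient_group y).
have := NM (NJ y (pi_repr x)) (pi_repr y).
by rewrite -/x' -/y' conjgE invgM !mulgA mulgK.
Qed.

Fact quotient_mulA : associative quotient_mul.
Proof.
move=> a b c; have [x ->] := pi_surj a.
have [y ->] := pi_surj b; have [z ->] := pi_surj c.
by rewrite !quotient_piM mulgA.
Qed.

Fact quotient_mul1 : left_id quotient_one quotient_mul.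
Proof. by move=> a; have [x ->] := pi_surj a; rewrite quotient_piM mul1g. Qed.

Fact quotient_mulg1 : right_id quotient_one quotient_mul.
Proof. by move=> a; have [x ->] := pi_surj a; rewrite quotient_piM mulg1. Qed.

Fact quotient_mulV : left_inverse quotient_one quotient_inv quotient_mul.
Proof.
by move=> a; have [x ->] := pi_surj a; rewrite quotient_piV quotient_piM mulVg.
Qed.

Fact quotient_mulgV : right_inverse quotient_one quotient_inv quotient_mul.
Proof.
by move=> a; have [x ->] := pi_surj a; rewrite quotient_piV quotient_piM mulgV.
Qed.

HB.instance Definition _ := isGroup.Build quotient_group
  quotient_mulA quotient_mul1 quotient_mulg1 quotient_mulV quotient_mulgV.

End QuotientGroup.

Definition abelianisation (G : groupType) : groupType :=
  quotient_group (NormalSubgroup (commutator_subgroupP G)).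

(* No group has order 0, so [has_order G (a - b)] with the truncated          *)
(* subtraction on nat entails b < a: truncation never takes effect.           *)
Definition has_order (G : groupType) (m : nat) : Prop := [set: G] #= `I_m.

Section FreeGroup.
Variable X : choiceType.

(* The letter (x, false) is the generator x, and (x, true) is its inverse. *)
Definition letter := (X * bool)%type.
Implicit Types (a b : letter) (u v w : seq letter).

Definition letter_inv a : letter := (a.1, ~~ a.2).

Definition reduced w : bool := sorted (fun a b => b != letter_inv a) w.

Definition push a w : seq letter :=
  if w is b :: w' then if b == letter_inv a then w' else a :: w else [:: a].

Definition word_inv w : seq letter := rev (map letter_inv w).

Let letter_invK : involutive letter_inv.
Proof. by case=> x b; rewrite /letter_inv /= negbK. Qed.

Let reduced_push a w : reduced w -> reduced (push a w).
Proof.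
case: w => //= b w rw; case: ifPn => [_|ne] /=; last by rewrite ne.
exact: path_sorted rw.
Qed.

Let reduced_foldr v w : reduced w -> reduced (foldr push w v).
Proof. by move=> rw; elim: v => //= a v; apply: reduced_push. Qed.

Let pushK a w : reduced w -> push a (push (letter_inv a) w) = w.
Proof.
case: w => [|b w] /=; first by rewrite eqxx.
rewrite letter_invK; have [-> {b}|ne] := eqVneq b a; last by rewrite /= eqxx.
by case: w => [|c w] //= /andP[/negPf ->].
Qed.

Let foldr_push a v w : reduced w ->
  foldr push w (push a v) = push a (foldr push w v).
Proof.
move=> rw; case: v => [|b v] //=; case: eqP => // ->.
by rewrite pushK //; apply: reduced_foldr.
Qed.

Let foldr_foldr u v w : reduced w ->
  foldr push w (foldr push v u) = foldr push (foldr push w v) u.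
Proof. by move=> rw; elim: u => //= a u IHu; rewrite foldr_push ?IHu. Qed.

Let foldr_nil w : reduced w -> foldr push [::] w = w.
Proof.
elim: w => //= a w IHw rw; rewrite IHw; last exact: path_sorted rw.
by case: w rw {IHw} => //= b w /andP[/negPf ->].
Qed.

Let reduced_word_inv w : reduced w -> reduced (word_inv w).
Proof.
rewrite /reduced /word_inv rev_sorted sorted_map.
by apply: sub_sorted => a b /=; rewrite letter_invK eq_sym.
Qed.

Let foldr_word_inv v w : reduced w ->
  foldr push (foldr push w v) (word_inv v) = w.
Proof.
move=> rw; rewrite /word_inv; elim: v => //= a v IHv.
rewrite rev_cons foldr_rcons -{2}[a]letter_invK pushK //.
exact: reduced_foldr.
Qed.

Definition free_group := {w : seq letter | reduced w}.
HB.instance Definition _ := Choice.on free_group.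
Implicit Types f g h : free_group.

Definition free_one : free_group := exist _ [::] isT.
Definition free_inv f : free_group :=
  exist _ (word_inv (val f)) (reduced_word_inv (valP f)).
Definition free_mul f g : free_group :=
  exist _ (foldr push (val g) (val f)) (reduced_foldr (val f) (valP g)).

Fact free_mulA : associative free_mul.
Proof. by move=> f g h; apply/val_inj; rewrite /= foldr_foldr ?(valP h). Qed.

Fact free_mul1 : left_id free_one free_mul.
Proof. by move=> f; apply/val_inj. Qed.

Fact free_mulg1 : right_id free_one free_mul.
Proof. by move=> f; apply/val_inj; rewrite /= foldr_nil ?(valP f). Qed.

Fact free_mulV : left_inverse free_one free_inv free_mul.
Proof.
move=> f; apply/val_inj => /=.
by rewrite -{1}(foldr_nil (valP f)) foldr_word_inv.
Qed.

Fact free_mulgV : right_inverse free_one free_inv free_mul.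
Proof.
move=> f; have invK : free_inv (free_inv f) = f.
  apply/val_inj; rewrite /= /word_inv map_rev revK -map_comp map_id_in //.
  by move=> a _; apply: letter_invK.
by rewrite -{1}invK free_mulV.
Qed.

HB.instance Definition _ := isGroup.Build free_group
  free_mulA free_mul1 free_mulg1 free_mulV free_mulgV.

Definition free_gen (x : X) : free_group := exist _ [:: (x, false)] isT.

(* A pair (u, v) in [rels] stands for the relation u = v. *)
Definition presented_group (rels : set (free_group * free_group)) : groupType :=
  quotient_group (NormalSubgroup
    (normal_closureP [set r : free_group | exists2 p, rels p & r = p.1 / p.2])).

End FreeGroup.

(* [ordS i] is the successor of [i] modulo [n]. *)
Definition fractional_fibonacci_group (k l n : nat) : groupType :=
  let x := @free_gen 'I_n in
  presented_group [set p | exists i : 'I_n,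
    p = (x i ^+ l * x (ordS i) ^+ k, x (ordS (ordS i)) ^+ l)].

(* Index 0 is outside the mathematical definition, which starts at 1; the     *)
(* value 2 is the one that extends the recurrence.                            *)
Fixpoint lucas_number (k l j : nat) : nat :=
  match j with
  | 0 => 2
  | 1 => k
  | 2 => (k ^ 2 + 2 * l ^ 2)%N
  | (j''.+1 as j').+1 =>
      (k * lucas_number k l j' + l ^ 2 * lucas_number k l j'')%N
  end.

(* Main.v *)
(* The abelianisation of a group with n generators and n relators is the      *)
(* cokernel of its integer relation matrix M, which by the Smith normal form  *)
(* is finite of order |det M| as soon as det M is nonzero.  Here M is the     *)
(* circulant matrix of l + k X - l X^2, so that det M is the product of the   *)
(* l + k w - l w^2 over the n-th roots of unity w.  Factoring the quadratic   *)
(* as -l (a - X) (b - X) with l a + l b = k and a b = -1 gives                *)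
(* det M = (-l)^n (a^n - 1) (b^n - 1), while V_n = (l a)^n + (l b)^n.         *)

Require Import Defs.
From HB Require Import structures.
From mathcomp Require Import all_boot all_algebra all_field.
From mathcomp Require Import boolp classical_sets functions cardinality.
From mathcomp Require Import ring.

Set Implicit Arguments.
Unset Strict Implicit.
Unset Printing Implicit Defensive.

Import GRing.Theory Num.Theory.

(** Abelianising a presented group turns words into exponent vectors: two words have the same image
    exactly when their vectors differ by an integer combination of the rows of M ([to_ab_eq]). Hence
    the order sought is the index of the row lattice of M in Z^n, which is |det M| when det M is
    nonzero ([int_lattice_index], [abelianisation_presented_group_order]). The determinant is found
    over the algebraic numbers by [det_circulant3]. Expanding (a^n - 1) (b^n - 1) with a b = -1
    gives det M = (-1)^n ((-1)^n l^n + l^n - V_n) ([det_fractional_fibonacci]), that is, V_n for odd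
    n and 2 l^n - V_n for even n. The inequality 2 l^n < V_n for even n ([lucas_number_even_gt])
    fixes the sign and shows that det M is nonzero. *)

(** * Quotient groups and cardinality *)

Section Quotients.
Local Open Scope group_scope.
Local Open Scope quotient_scope.

Lemma quotient_piP (G : groupType) (N : normalSubgroup G) (x y : G) :
  (\pi_(quotient_group N) x = \pi_(quotient_group N) y) <->
  normal_set N (x^-1 * y).
Proof.
split=> [/eqP|Nxy]; first by rewrite eqmodE => /asboolP.
by apply/eqP; rewrite eqmodE; apply/asboolP.
Qed.

Lemma quotient_pi_repr (G : groupType) (N : normalSubgroup G) (x : G) :
  normal_set N (x^-1 * repr (\pi_(quotient_group N) x)).
Proof. by apply/quotient_piP; rewrite reprK. Qed.

Lemma quotient_pi_commg (G : groupType) (N : normalSubgroup G) (x y : G) :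
  \pi_(quotient_group N) [~ x, y] =
  [~ \pi_(quotient_group N) x, \pi_(quotient_group N) y].
Proof.
rewrite commgEl conjgE -(quotient_piM N x^-1) -(quotient_piM N y^-1).
by rewrite -(quotient_piM N x) -!quotient_piV.
Qed.

Lemma abelianisation_mulC (G : groupType) :
  commutative (fun a b : abelianisation G => a * b).
Proof.
move=> a b; rewrite -[a]reprK -[b]reprK.
rewrite [LHS]quotient_piM [RHS]quotient_piM.
apply/quotient_piP => H _; apply.
exists (repr b), (repr a).
by rewrite commgEl conjgE invgM !mulgA.
Qed.

Lemma has_order_bij (G : groupType) (T : finType) (f : G -> T) :
  injective f -> (forall t, exists x, f x = t) -> has_order G #|T|.
Proof.
move=> f_inj f_surj; rewrite /has_order.
pose h x := nat_of_ord (enum_rank (f x)).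
have h_inj : injective h by move=> x y /val_inj /enum_rank_inj /f_inj.
have -> : `I_#|T| = (h @` [set: G])%classic.
  apply/seteqP; split=> [i /= ltiT|_ [x _ <-]] /=; last exact: ltn_ord.
  have [x fx] := f_surj (enum_val (Ordinal ltiT)).
  by exists x => //; rewrite /h fx enum_valK.
by rewrite card_eq_sym; apply: inj_card_eq => x y _ _; apply: h_inj.
Qed.

End Quotients.

(** * Homomorphisms from a free group to an abelian group *)

Section FreeLift.
Local Open Scope ring_scope.
Variables (X : choiceType) (V : zmodType) (phi : X -> V).

Definition letter_lift (a : letter X) : V := if a.2 then - phi a.1 else phi a.1.

Definition free_lift (f : free_group X) : V := \sum_(a <- val f) letter_lift a.

Lemma letter_lift_inv a : letter_lift (letter_inv a) = - letter_lift a.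
Proof. by case: a => x [] /=; rewrite /letter_lift /= ?opprK. Qed.

Lemma free_lift1 : free_lift 1%g = 0.
Proof. exact: big_nil. Qed.

(** Reduction only ever cancels a letter against its inverse, and their contributions to the sum are
    opposite. *)
Lemma free_liftM f g : free_lift (f * g)%g = free_lift f + free_lift g.
Proof.
rewrite /free_lift /=; elim: (val f) => [|a s IHs] /=.
  by rewrite big_nil add0r.
rewrite big_cons -addrA -IHs.
case: (foldr _ _ _) => [|b w] /=; first by rewrite big_seq1 big_nil addr0.
case: eqP => [->|_]; last by rewrite big_cons.
by rewrite big_cons letter_lift_inv addNKr.
Qed.

Lemma free_liftV f : free_lift f^-1%g = - free_lift f.
Proof.
by apply: (addrI (free_lift f)); rewrite -free_liftM mulgV free_lift1 subrr.
Qed.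

Lemma free_liftX f m : free_lift (f ^+ m)%g = free_lift f *+ m.
Proof.
elim: m => [|m IHm]; first by rewrite expg0 free_lift1.
by rewrite expgS free_liftM IHm mulrS.
Qed.

Lemma free_lift_gen x : free_lift (free_gen x) = phi x.
Proof. exact: big_seq1. Qed.

Lemma free_liftE (t : free_group X -> V) :
    (forall f g, t (f * g)%g = t f + t g) ->
    (forall x, t (free_gen x) = phi x) ->
  t =1 free_lift.
Proof.
move=> tM t_gen.
have t1 : t 1%g = 0 by apply: (addrI (t 1%g)); rewrite -tM mulg1 addr0.
have tV f : t f^-1%g = - t f.
  by apply: (addrI (t f)); rewrite -tM mulgV t1 subrr.
have t_letter a : t (exist _ [:: a] isT) = letter_lift a.
  case: a => x []; rewrite /letter_lift /= -t_gen // -tV.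
  by congr t; apply: val_inj.
case; elim=> [|a s IHs] rs; rewrite /free_lift /=.
  by rewrite big_nil -t1; congr t; apply: val_inj.
have rs' : reduced s by apply: path_sorted rs.
rewrite big_cons -[X in _ + X](IHs rs') -t_letter -tM; congr t.
(* Since [a :: s] is reduced, pushing [a] onto [s] cancels nothing, so the word is the product of
   its head and its tail. *)
apply: val_inj => /=.
by case: s rs {IHs rs'} => //= b s /andP[/negPf ->].
Qed.

End FreeLift.

Lemma free_lift_raddf (X : choiceType) (U V : zmodType)
    (h : {additive U -> V}) (phi : X -> U) f :
  h (free_lift phi f) = free_lift (h \o phi) f.
Proof.
rewrite /free_lift raddf_sum; apply: eq_bigr => -[x []] _ //=.
by rewrite /letter_lift /= raddfN.
Qed.

Section ExponentVectors.
Local Open Scope ring_scope.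
Variable n : nat.

Definition exponents (f : free_group 'I_n) : 'rV[int]_n :=
  free_lift (fun i => delta_mx 0 i) f.

Lemma exponents1 : exponents 1%g = 0.
Proof. exact: free_lift1. Qed.

Lemma exponentsM f g : exponents (f * g)%g = exponents f + exponents g.
Proof. exact: free_liftM. Qed.

Lemma exponentsV f : exponents f^-1%g = - exponents f.
Proof. exact: free_liftV. Qed.

Lemma exponentsX f m : exponents (f ^+ m)%g = exponents f *+ m.
Proof. exact: free_liftX. Qed.

Lemma exponents_gen i : exponents (free_gen i) = delta_mx 0 i.
Proof. exact: free_lift_gen. Qed.

Lemma exponents_div f g : exponents (f / g)%g = exponents f - exponents g.
Proof. by rewrite exponentsM exponentsV. Qed.

Lemma exponents_surj v : exists f, exponents f = v.
Proof.
have gen_mulz i (z : int) : exists f, exponents f = z *: delta_mx 0 i.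
  case: z => m; first exists (free_gen i ^+ m)%g.
    by rewrite exponentsX exponents_gen -scaler_nat natz.
  exists (free_gen i ^+ m.+1)^-1%g.
  rewrite exponentsV exponentsX exponents_gen -scaler_nat natz.
  by rewrite NegzE scaleNr.
rewrite [v]row_sum_delta.
apply: (big_ind (fun u => exists f, exponents f = u)).
- by exists 1%g; apply: exponents1.
- by move=> _ _ [f <-] [g <-]; exists (f * g)%g; apply: exponentsM.
- by move=> i _; apply: gen_mulz.
Qed.

Definition linear_comb (V : zmodType) (phi : 'I_n -> V) (v : 'rV[int]_n) : V :=
  \sum_i phi i *~ v 0 i.

Fact linear_comb_is_additive V phi : zmod_morphism (@linear_comb V phi).
Proof.
move=> u v; rewrite /linear_comb -sumrB; apply: eq_bigr => i _.
by rewrite !mxE mulrzBr.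
Qed.
HB.instance Definition _ V phi :=
  GRing.isZmodMorphism.Build _ _ _ (@linear_comb_is_additive V phi).

(** Z^n is the abelianisation of the free group: homomorphisms to abelian groups factor through
    [exponents]. *)
Lemma free_lift_exponents (V : zmodType) (phi : 'I_n -> V) f :
  free_lift phi f = linear_comb phi (exponents f).
Proof.
rewrite [RHS]free_lift_raddf; congr free_lift; apply/funext => i /=.
rewrite /linear_comb (bigD1 i) //= big1 ?mxE ?eqxx ?addr0 //.
by move=> j; rewrite mxE eqxx => /negPf ->.
Qed.

End ExponentVectors.

(** * The index of a full-rank integer lattice *)

Section Lattices.
Local Open Scope ring_scope.

Lemma absz_det_unitmx n (L : 'M[int]_n) : L \in unitmx -> `|\det L|%N = 1%N.
Proof. by rewrite unitmxE => /orP[] /eqP ->. Qed.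

(** Write M = L D R in Smith normal form. Then v |-> v R^-1 carries the row lattice of M to that of
    D, so the cokernel is the product of the Z/d_i; [c] records the residues. *)
Lemma int_lattice_index n (M : 'M[int]_n) : \det M != 0 ->
  exists (T : finType) (c : 'rV[int]_n -> T),
    [/\ #|T| = `|\det M|%N, forall t, exists v, c v = t
      & forall u v, c u = c v <-> exists w, u - v = w *m M].
Proof.
have [L uL [R uR [s _ defM]]] := int_Smith_normal_form M.
pose d (i : 'I_n) := s`_i.
have {defM} defM : M = L *m diag_mx (\row_i d i) *m R.
  by rewrite defM; congr (_ *m _ *m _); apply/matrixP => i j; rewrite !mxE.
have detM : `|\det M|%N = (\prod_i `|d i|)%N.
  rewrite defM !det_mulmx det_diag !abszM !absz_det_unitmx // mul1n muln1.
  by rewrite (big_morph absz abszM erefl); apply: eq_bigr => i _; rewrite mxE.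
rewrite -absz_gt0 detM => d_gt0'.
have d_gt0 i : (0 < `|d i|)%N by apply: gt0_prodn d_gt0' _ _.
have d_neq0 i : d i != 0 by rewrite -absz_gt0.
(* The form [.-1.+1] is a visible successor, as [inord] demands; it equals |d_i| because d_i is
   nonzero. *)
have modd_lt z i : (`|(z %% d i)%Z| < `|d i|.-1.+1)%N.
  by rewrite prednK // -ltz_nat gez0_abs ?modz_ge0 // ltz_mod.
exists {dffun forall i : 'I_n, 'I_(`|d i|.-1.+1)}.
exists (fun v : 'rV_n =>
  [ffun i => inord `|((v *m invmx R) ord0 i %% d i)%Z|%N]).
split=> [|t|u v].
- rewrite card_dep_ffun foldrE big_map big_enum; apply: eq_bigr => i _.
  by rewrite card_ord prednK.
- exists ((\row_i (t i : nat)%:Z) *m R); apply/ffunP => i.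
  rewrite ffunE mulmxK // mxE -[RHS]inord_val; congr inord.
  have lt_t := ltn_ord (t i).
  by rewrite -modz_abs modz_nat /= modn_small // -[X in (_ < X)%N]prednK.
- have latticeP : (exists w, u - v = w *m M) <->
      forall i, (d i %| ((u - v) *m invmx R) ord0 i)%Z.
    split=> [[w ->] i|dvd_d].
      by rewrite defM !mulmxA mulmxK // mul_mx_diag !mxE dvdz_mull.
    exists ((\row_i (((u - v) *m invmx R) ord0 i %/ d i)%Z) *m invmx L).
    rewrite defM !mulmxA mulmxKV // -[LHS](mulmxKV uR); congr (_ *m _).
    apply/rowP => i; rewrite mul_mx_diag [RHS]mxE.
    by rewrite [X in X * _]mxE [X in _ * X]mxE divzK.
  apply: iff_trans (iff_sym latticeP).
  have dvdE i : (d i %| ((u - v) *m invmx R) ord0 i)%Z =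
      ((u *m invmx R) ord0 i == (v *m invmx R) ord0 i %[mod d i])%Z.
    by rewrite eqz_mod_dvd mulmxBl !mxE.
  split=> [/ffunP c_eq i|dvd_d].
    have := congr1 val (c_eq i); rewrite !ffunE /= !inordK // dvdE.
    by move=> /(congr1 Posz); rewrite !gez0_abs ?modz_ge0 // => /eqP.
  apply/ffunP => i; rewrite !ffunE; congr (inord `|_|%N); apply/eqP.
  by rewrite -dvdE.
Qed.

End Lattices.

(** An alias that carries the group law additively, so that [free_lift] and [linear_comb] can take
    values in it. *)
Definition additive_abelianisation (G : groupType) : Type := abelianisation G.

Section AdditiveAbelianisation.
Variable G : groupType.
HB.instance Definition _ := Choice.on (additive_abelianisation G).
HB.instance Definition _ := GRing.isZmodule.Build (additive_abelianisation G)
  (@mulgA (abelianisation G)) (@abelianisation_mulC G)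
  (@mul1g (abelianisation G)) (@mulVg (abelianisation G)).
End AdditiveAbelianisation.

(** * The abelianisation as the cokernel of the relation matrix *)

Section PresentedGroups.
Local Open Scope ring_scope.
Variables (n : nat) (r : 'I_n -> free_group 'I_n * free_group 'I_n).

Let G := presented_group [set p | exists i, p = r i]%classic.
Let N := NormalSubgroup (normal_closureP [set x : free_group 'I_n |
  exists2 p, [set p | exists i, p = r i]%classic p &
             x = (p.1 / p.2)%g]%classic).

Definition relation_matrix : 'M[int]_n :=
  \matrix_(i < n) (exponents (r i).1 - exponents (r i).2).

Let in_lattice (v : 'rV[int]_n) :=
  exists w : 'rV[int]_n, v = w *m relation_matrix.

Let in_lattice0 : in_lattice 0.
Proof. by exists 0; rewrite mul0mx. Qed.

Let in_latticeB u v : in_lattice u -> in_lattice v -> in_lattice (u - v).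
Proof. by move=> [u' ->] [v' ->]; exists (u' - v'); rewrite mulmxBl. Qed.

Let in_latticeN u : in_lattice u -> in_lattice (- u).
Proof. by rewrite -sub0r; apply: in_latticeB. Qed.

Let in_lattice_sub u v : in_lattice (u - v) -> in_lattice u <-> in_lattice v.
Proof.
move=> Luv; split=> [Lu|Lv]; first by rewrite -[v](subKr u); apply: in_latticeB.
rewrite -(subrK v u) -[X in _ + X]opprK; apply: in_latticeB => //.
exact: in_latticeN.
Qed.

(** The words with exponents in the lattice form a normal subgroup, conjugation leaving exponents
    unchanged, and it contains the relators. *)
Let exponents_normal f : normal_set N f -> in_lattice (exponents f).
Proof.
move=> /(_ [set x | in_lattice (exponents x)]%classic).
apply=> [|_ [_ [i ->] ->]] /=; last first.
  by exists (delta_mx 0 i); rewrite -rowE rowK; exact: exponents_div.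
split; [split=> [|f1 f2 Lf1 Lf2]|move=> f1 f2 Lf1] => /=.
- by rewrite exponents1.
- by rewrite exponents_div; apply: in_latticeB.
- by rewrite conjgE !exponentsM exponentsV addrC addrK.
Qed.

Let exponents_repr f :
  in_lattice (exponents (repr (\pi_(quotient_group N)%qT f))) <->
  in_lattice (exponents f).
Proof.
apply: in_lattice_sub.
have /exponents_normal := quotient_pi_repr N f.
by rewrite exponentsM exponentsV addrC.
Qed.

Let to_ab (f : free_group 'I_n) : additive_abelianisation G :=
  \pi_(abelianisation G)%qT (\pi_(quotient_group N)%qT f).

Let to_abM f g : to_ab (f * g)%g = to_ab f + to_ab g.
Proof. by rewrite /to_ab -quotient_piM -[LHS]quotient_piM. Qed.

(** From right to left, [to_ab] factors through [exponents] and kills every row of the matrix. From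
    left to right, the elements of G whose representatives have exponents in the lattice form a
    subgroup containing all commutators. *)
Let to_ab_eq f g :
  to_ab f = to_ab g <-> in_lattice (exponents f - exponents g).
Proof.
have to_abE h :
    to_ab h = linear_comb (fun i => to_ab (free_gen i)) (exponents h).
  by rewrite -free_lift_exponents; apply: free_liftE.
split=> [fg|[w fgE]]; last first.
  apply/eqP; rewrite -subr_eq0 !to_abE -raddfB fgE mulmx_sum_row raddf_sum.
  apply/eqP/big1 => i _; rewrite rowK -[w 0 i]intz scaler_int raddfMz raddfB /=.
  rewrite -!to_abE (_ : to_ab _ = to_ab (r i).2) ?subrr ?mul0rz //.
  congr \pi_(_)%qT; apply/quotient_piP => K [[K1 KF] KJ] KR.
  have KV x : K x -> K x^-1%g by move=> Kx; rewrite -div1g; apply: KF.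
  (* The relator is u v^-1, whereas cosets are compared through u^-1 v: invert, then conjugate by
     u. *)
  have /KV/(KJ _ (r i).1) : K ((r i).1 / (r i).2)%g.
    by apply: KR; exists (r i) => //; exists i.
  by rewrite conjgE invgM invgK !mulgA mulgVK.
have in_comm : commutator_subgroup (\pi_(quotient_group N)%qT (f^-1 * g)%g : G).
  have /quotient_piP := fg; rewrite /= -[(_ * _)%g]/(quotient_mul _ _).
  by rewrite -[(_^-1)%g]/(quotient_inv _) quotient_piV quotient_piM.
have /exponents_repr :
    in_lattice (exponents (repr (\pi_(quotient_group N)%qT (f^-1 * g)%g))).
  pose H := [set x : G | in_lattice (exponents (repr x))]%classic.
  apply: (in_comm H) => [|_ [x [y ->]]] /=; first split=> [|x y Lx Ly] /=.
  - by apply/exponents_repr; rewrite exponents1.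
  - rewrite -[x]reprK -[y]reprK -[(_ / _)%g]/(quotient_mul _ (quotient_inv _)).
    rewrite quotient_piV quotient_piM; apply/exponents_repr.
    by rewrite exponents_div; apply: in_latticeB.
  - rewrite -[x]reprK -[y]reprK.
    rewrite -quotient_pi_commg; apply/exponents_repr; rewrite commgEl conjgE.
    rewrite !(exponentsM, exponentsV) [X in _ + (_ + X)]addrC addKr addNr.
    exact: in_lattice0.
rewrite exponentsM exponentsV => Lfg.
by rewrite -opprB addrC; apply: in_latticeN.
Qed.

Lemma abelianisation_presented_group_order :
  \det relation_matrix != 0 ->
  has_order
    (abelianisation (presented_group [set p | exists i, p = r i]%classic))
    `|\det relation_matrix|%N.
Proof.
move=> /int_lattice_index [T [c [<- c_surj cE]]].
pose c' (a : abelianisation G) := c (exponents (repr (repr a))).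
have c'E f : c' (to_ab f) = c (exponents f).
  by apply/cE/to_ab_eq; rewrite /to_ab !reprK.
have to_ab_surj (a : abelianisation G) : exists f, a = to_ab f.
  by exists (repr (repr a)); rewrite /to_ab !reprK.
apply: (@has_order_bij _ _ c') => [a b|t].
  have [f ->] := to_ab_surj a; have [g ->] := to_ab_surj b.
  by rewrite !c'E => /cE/to_ab_eq.
have [v <-] := c_surj t; have [f <-] := exponents_surj v.
by exists (to_ab f).
Qed.

End PresentedGroups.

(** * Binet formula and growth of V_j *)

Section LucasNumbers.
Local Open Scope nat_scope.
Variables k l : nat.

Lemma lucas_numberSS j : lucas_number k l j.+2 =
  k * lucas_number k l j.+1 + l ^ 2 * lucas_number k l j.
Proof. by case: j => //=; rewrite mulnn [l ^ 2 * 2]mulnC. Qed.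

Lemma lucas_number_gt0 j : 0 < k -> 0 < lucas_number k l j.
Proof.
move=> k_gt0.
suff /andP[] : (0 < lucas_number k l j) && (0 < lucas_number k l j.+1) by [].
elim: j => [|j /andP[IHj IHj1]]; first by rewrite k_gt0.
by rewrite IHj1 lucas_numberSS addn_gt0 muln_gt0 k_gt0 IHj1.
Qed.

(** V_{j+2} exceeds l^2 V_j by k V_{j+1} > 0; iterate from V_0 = 2. *)
Lemma lucas_number_double_gt m :
  0 < k -> 2 * l ^ m.+1.*2 < lucas_number k l m.+1.*2.
Proof.
move=> k_gt0.
have lt_step j : l ^ 2 * lucas_number k l j < lucas_number k l j.+2.
  rewrite lucas_numberSS -[X in X < _]add0n ltn_add2r muln_gt0 k_gt0.
  exact: lucas_number_gt0.
elim: m => [|m IHm]; first by rewrite mulnC; apply: lt_step 0.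
have -> : 2 * l ^ m.+2.*2 = l ^ 2 * (2 * l ^ m.+1.*2).
  by rewrite (doubleS m.+1) -[_.*2.+2]addn2 expnD mulnA mulnC.
by apply: leq_ltn_trans (lt_step _); rewrite leq_mul2l ltnW ?orbT.
Qed.

(** Binet formula: x and y are the roots of t^2 - k t - l^2, the characteristic polynomial of the
    recurrence. *)
Lemma lucas_number_powers (R : comNzRingType) (x y : R) j :
  (x + y = k%:R -> x * y = - l%:R ^+ 2 ->
   (lucas_number k l j)%:R = x ^+ j + y ^+ j)%R.
Proof.
move=> xDy xMy.
suff [] : ((lucas_number k l j)%:R = x ^+ j + y ^+ j /\
  (lucas_number k l j.+1)%:R = x ^+ j.+1 + y ^+ j.+1)%R by [].
elim: j => [|j [IHj IHj1]]; first by rewrite !expr0 !expr1 xDy.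
split=> //; rewrite lucas_numberSS natrD 2!natrM IHj IHj1 -xDy.
have -> : ((l ^ 2)%:R = - (x * y) :> R)%R by rewrite xMy natrX opprK.
rewrite !exprS.
ring.
Qed.

Lemma lucas_number_even_gt n :
  0 < k -> 1 < n -> ~~ odd n -> 2 * l ^ n < lucas_number k l n.
Proof.
move=> k_gt0 n_gt1 /negPf even_n; rewrite -[n]odd_double_half even_n add0n.
rewrite -(@prednK n./2) ?half_gt0 //; exact: lucas_number_double_gt.
Qed.

End LucasNumbers.

(** * Circulant determinants *)

Section Circulant.
Local Open Scope ring_scope.

Lemma prod_sub_root_unity (F : fieldType) (n : nat) (z x : F) :
  n.-primitive_root z -> \prod_(i < n) (x - z ^+ i) = x ^+ n - 1.
Proof.
move=> /factor_Xn_sub_1 /(congr1 (horner^~ x)).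
rewrite horner_prod big_mkord !hornerE => <-.
by apply: eq_bigr => i _; rewrite !hornerE.
Qed.

(* The Fourier matrix diagonalises the circulant matrix M. *)
Lemma det_circulant3 (F : fieldType) (n : nat) (z a b c : F) (M : 'M[F]_n) :
    n.-primitive_root z ->
    (forall i, row i M = a *: delta_mx 0 i + b *: delta_mx 0 (ordS i)
                         + c *: delta_mx 0 (ordS (ordS i))) ->
  \det M = \prod_(j < n) (a + b * z ^+ j + c * (z ^+ j) ^+ 2).
Proof.
move=> prim_z rowM.
pose V := \matrix_(i < n, j < n) (z ^+ j) ^+ i.
have detV : \det V != 0.
  have -> : V = Vandermonde n (\row_j z ^+ j).
    by apply/matrixP => i j; rewrite !mxE.
  rewrite det_Vandermonde; apply/prodf_neq0 => i _; apply/prodf_neq0 => j lt_ij.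
  rewrite !mxE subr_eq0 (eq_prim_root_expr prim_z) !modn_small //.
  by rewrite gtn_eqF.
pose D := \row_(j < n) (a + b * z ^+ j + c * (z ^+ j) ^+ 2).
(* The wraparound in [ordS] is harmless because (z^j)^n = 1. *)
have zS (i j : 'I_n) : (z ^+ j) ^+ ordS i = (z ^+ j) ^+ i.+1.
  by rewrite /= expr_mod // -exprM mulnC exprM (prim_expr_order prim_z) expr1n.
(* The columns of V are eigenvectors of M. As rows are sums of delta vectors, the case n = 2, where
   [ordS (ordS i)] is [i], needs no separate treatment. *)
have MV : M *m V = V *m diag_mx D.
  apply/row_matrixP => i; rewrite row_mul rowM !mulmxDl -!scalemxAl -!rowE.
  apply/rowP => j; rewrite mul_mx_diag !mxE !zS !exprS zS exprS.
  ring.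
apply: (mulIf detV); rewrite -det_mulmx MV det_mulmx det_diag mulrC.
by congr (_ * _); apply: eq_bigr => j _; rewrite mxE.
Qed.

End Circulant.

(** * The determinant for F^{k/l}(n) *)

Section FractionalFibonacci.
Local Open Scope ring_scope.
Variables k l n : nat.

Definition fractional_fibonacci_rel (i : 'I_n) :
    free_group 'I_n * free_group 'I_n :=
  let x := @free_gen 'I_n in
  (x i ^+ l * x (ordS i) ^+ k, x (ordS (ordS i)) ^+ l)%g.

Let M := relation_matrix fractional_fibonacci_rel.

Lemma det_fractional_fibonacci : (0 < l)%N -> (0 < n)%N ->
  \det M = (-1) ^+ n *
    ((-1) ^+ n * (l ^ n)%:R + (l ^ n)%:R - (lucas_number k l n)%:R).
Proof.
move=> l_gt0 n_gt0; have [z prim_z] := C_prim_root_exists n_gt0.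
(* The square root of the discriminant of l + k X - l X^2, whose roots are a and b below. *)
pose s : algC := sqrtC (k ^ 2 + 4 * l ^ 2)%:R.
have sK : s ^+ 2 = k%:R ^+ 2 + 4%:R * l%:R ^+ 2.
  by rewrite sqrtCK natrD natrM !natrX.
have l_neq0 : (l%:R : algC) != 0 by rewrite pnatr_eq0 -lt0n.
pose a : algC := (k%:R + s) / 2%:R / l%:R.
pose b : algC := (k%:R - s) / 2%:R / l%:R.
have aDb : l%:R * a + l%:R * b = k%:R by rewrite /a /b; field; rewrite l_neq0.
have aMb : a * b = -1.
  have -> : a * b = (k%:R ^+ 2 - s ^+ 2) / (4%:R * l%:R ^+ 2).
    by rewrite /a /b; field; rewrite l_neq0.
  by rewrite sK; field; rewrite l_neq0.
clearbody a b; clear s sK.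
have factor x :
    l%:R + k%:R * x + - l%:R * x ^+ 2 = - l%:R * ((a - x) * (b - x)).
  by rewrite -aDb mulrBl !mulrBr aMb; ring.
apply: (@intr_inj algC); rewrite -det_map_mx.
rewrite (@det_circulant3 _ _ z l%:R k%:R (- l%:R)) //; last first.
  move=> i; apply/rowP => j.
  rewrite !mxE /= !(exponentsM, exponentsX, exponents_gen) -!scaler_nat !mxE.
  by rewrite !(rmorphD, rmorphB, rmorphN, rmorphM) /= !rmorph_nat; ring.
under eq_bigr => j _ do rewrite factor.
rewrite big_split prodr_const card_ord big_split /= !prod_sub_root_unity //.
have lucasE := @lucas_number_powers k l algC (l%:R * a) (l%:R * b) n aDb _.
rewrite !(rmorphM, rmorphB, rmorphD, rmorphXn, rmorphN) /= !rmorph1 !rmorph_nat.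
rewrite lucasE; last by rewrite mulrACA aMb mulrN1.
rewrite !exprMn exprNn.
(* Once the sign is written as a^n b^n, a polynomial identity in a^n, b^n and l^n remains. *)
have <- : a ^+ n * b ^+ n = (-1) ^+ n by rewrite -exprMn aMb.
by ring.
Qed.

Lemma absz_det_fractional_fibonacci : (0 < k)%N -> (0 < l)%N -> (1 < n)%N ->
  `|\det M|%N = (if odd n then lucas_number k l n
                 else lucas_number k l n - 2 * l ^ n)%N.
Proof.
move=> k_gt0 l_gt0 n_gt1; rewrite det_fractional_fibonacci ?(ltnW n_gt1) //.
rewrite -signr_odd; case: ifPn => odd_n.
  by rewrite !mulN1r addNr add0r opprK natz.
(* For even n the determinant is 2 l^n - V_n, which is negative, so its absolute value is the
   untruncated difference V_n - 2 l^n. *)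
have le_lucas := ltnW (lucas_number_even_gt l k_gt0 n_gt1 odd_n).
rewrite expr0 !mul1r -natrD addnn -mul2n !natz -opprB abszN.
by rewrite distnEl.
Qed.

End FractionalFibonacci.

Theorem theorem3p1 (k l n : nat) (hk : 1 <= k) (hl : 1 <= l) (hn : 2 <= n) :
  has_order (abelianisation (fractional_fibonacci_group k l n))
    (if odd n then lucas_number k l n else lucas_number k l n - 2 * l ^ n).
Proof.
have detE := absz_det_fractional_fibonacci hk hl hn.
rewrite -detE; apply: abelianisation_presented_group_order.
rewrite -absz_gt0 detE; case: ifPn => [_|even_n].
  exact: lucas_number_gt0.
by rewrite subn_gt0; apply: lucas_number_even_gt.
Qed.
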